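(* Let $l=5$, $r\in\{1,2\}$, $a=[r]$ and $b=[2r]$. Then $p_{8,0}(1/a)=b^{16}$.
   Context: For an integer $i$, $[i]=\sum x^{n^2}\in\mathbb{Z}/2[[x]]$, summed over $n\in\mathbb{Z}$ with $n\equiv i\pmod 5$. $1/a$ is taken in the field $L$ of Laurent series over $\mathbb{Z}/2$. For $q$ a power of $2$ and $0\le j<q$, $p_{q,j}:L\to L$ is $\sum_n c_nx^n\mapsto\sum_{n\equiv j\pmod q}c_nx^n$ (the projection onto $x^jL^{q}$ in $L=\bigoplus_{0\le j<q}x^jL^{q}$, $L^{q}$ the subfield of $q$th powers). *)

(* Defs.v *)
From HB Require Import structures.
From mathcomp Require Import all_boot all_order all_algebra.
From mathcomp Require Import zify.
From mathcomp Require Import boolp classical_sets functions cardinality fsbigop.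

Set Implicit Arguments.
Unset Strict Implicit.
Unset Printing Implicit Defensive.

Import Order.TTheory GRing.Theory Num.Theory.
Local Open Scope classical_set_scope.
Local Open Scope ring_scope.

(** Formal Laurent series over a field [K]: families of coefficients indexed
    by [int] that vanish below some index. *)

Section LaurentSeries.
Variable K : fieldType.

Definition vanish_below (M : int) (c : int -> K) :=
  forall n : int, n < M -> c n = 0.

Record laurent := Laurent {
  lcoef :> int -> K;
  lcoef_bounded : exists M, vanish_below M lcoef }.

HB.instance Definition _ := gen_eqMixin laurent.
HB.instance Definition _ := gen_choiceMixin laurent.

Lemma laurentP (f g : laurent) : (forall n, f n = g n) -> f = g.
Proof.
case: f g => [f Bf] [g Bg] /= /funext fg; rewrite -fg in Bg *.
by congr Laurent; exact: Prop_irrelevance.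
Qed.

Lemma vanish_belowW (M N : int) (c : int -> K) :
  N <= M -> vanish_below M c -> vanish_below N c.
Proof. by move=> NM Mc n nN; apply: Mc; apply: lt_le_trans NM. Qed.

Lemma vanish_below_le (f : laurent) (n : int) :
  exists2 M : int, M <= n & vanish_below M f.
Proof.
have [M Mf] := lcoef_bounded f; exists (Num.min M n); first by lia.
by apply: vanish_belowW Mf; lia.
Qed.

Lemma laurent0_subproof : exists M, vanish_below M (fun=> 0).
Proof. by exists 0. Qed.
Definition laurent0 := Laurent laurent0_subproof.

Lemma laurent_opp_subproof (f : laurent) :
  exists M, vanish_below M (fun n => - f n).
Proof.
by have [M Mf] := lcoef_bounded f; exists M => n nM; rewrite Mf ?oppr0.
Qed.
Definition laurent_opp f := Laurent (laurent_opp_subproof f).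

Lemma laurent_add_subproof (f g : laurent) :
  exists M, vanish_below M (fun n => f n + g n).
Proof.
have [N Ng] := lcoef_bounded g; have [M MN Mf] := vanish_below_le f N.
by exists M => n nM; rewrite Mf // (vanish_belowW MN Ng) // addr0.
Qed.
Definition laurent_add f g := Laurent (laurent_add_subproof f g).

Lemma laurent_addA : associative laurent_add.
Proof. by move=> f g h; apply: laurentP => n /=; rewrite addrA. Qed.
Lemma laurent_addC : commutative laurent_add.
Proof. by move=> f g; apply: laurentP => n /=; rewrite addrC. Qed.
Lemma laurent_add0 : left_id laurent0 laurent_add.
Proof. by move=> f; apply: laurentP => n /=; rewrite add0r. Qed.
Lemma laurent_addN : left_inverse laurent0 laurent_opp laurent_add.
Proof. by move=> f; apply: laurentP => n /=; rewrite addNr. Qed.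

HB.instance Definition _ := GRing.isZmodule.Build laurent
  laurent_addA laurent_addC laurent_add0 laurent_addN.

Lemma laurent1_subproof : exists M, vanish_below M (fun n => (n == 0)%:R).
Proof. by exists 0 => n; case: eqP => // ->. Qed.
Definition laurent1 := Laurent laurent1_subproof.

(** Cauchy product; the support of the sum is finite because both factors
    vanish below some index. *)
Definition cauchy (f g : int -> K) (n : int) : K :=
  \sum_(i \in [set: int]) (f i * g (n - i)).

Lemma cauchyE (f g : int -> K) (M N n : int) (k : nat) :
  vanish_below M f -> vanish_below N g -> n < M + N + k%:Z ->
  cauchy f g n = \sum_(i < k) f (M + i%:Z) * g (n - (M + i%:Z)).
Proof.
move=> Mf Ng nk; rewrite /cauchy.
rewrite -(big_mkord xpredT (fun i => f (M + i%:Z) * g (n - (M + i%:Z)))).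
have inj : injective (fun i : nat => M + i%:Z) by move=> i j /=; lia.
rewrite /index_iota subn0.
rewrite -(big_map (fun i : nat => M + i%:Z) xpredT (fun i => f i * g (n - i))).
set r := map _ _.
rewrite -(@fsbig_widen _ _ _ _ [set` r]) //; last first.
  move=> i [_ /=] /negP ri; apply: contrapT => /eqP fg0.
  case/negP: ri; apply/mapP; exists (absz (i - M)%R).
    rewrite mem_iota /=; have iM : M <= i.
      by rewrite leNgt; apply: contra_neqN fg0 => /Mf ->; rewrite mul0r.
    have : N <= n - i.
      by rewrite leNgt; apply: contra_neqN fg0 => /Ng ->; rewrite mulr0.
    lia.
  have : M <= i; last by lia.
  by rewrite leNgt; apply: contra_neqN fg0 => /Mf ->; rewrite mul0r.
by rewrite -fsbig_seq // map_inj_uniq // iota_uniq.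
Qed.

Lemma cauchy_vanish (f g : int -> K) (M N : int) :
  vanish_below M f -> vanish_below N g -> vanish_below (M + N) (cauchy f g).
Proof.
by move=> Mf Ng n nMN; rewrite (cauchyE (k := 0) Mf Ng) ?big_ord0 ?addr0.
Qed.

Lemma laurent_mul_subproof (f g : laurent) :
  exists M, vanish_below M (cauchy f g).
Proof.
have [[M Mf] [N Ng]] := (lcoef_bounded f, lcoef_bounded g).
by exists (M + N); exact: cauchy_vanish.
Qed.
Definition laurent_mul f g := Laurent (laurent_mul_subproof f g).

(* The ring axioms are obtained from those of [{poly K}] by truncation. *)
Definition trunc (M : int) (k : nat) (f : int -> K) : {poly K} :=
  \poly_(i < k) f (M + i%:Z).

Lemma coef_trunc_mul (f g : int -> K) (M N : int) (k j : nat) :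
  vanish_below M f -> vanish_below N g -> (j < k)%N ->
  cauchy f g (M + N + j%:Z) = (trunc M k f * trunc N k g)`_j.
Proof.
move=> Mf Ng jk; rewrite (cauchyE (k := j.+1) Mf Ng); last by lia.
rewrite coefM; apply: eq_bigr => i _; rewrite !coef_poly.
have ij : (i <= j)%N by rewrite -ltnS.
rewrite (leq_ltn_trans ij jk) (leq_ltn_trans (leq_subr i j) jk).
by congr (_ * g _); lia.
Qed.

Lemma trunc_mul (f g : int -> K) (M N : int) (k : nat) :
  vanish_below M f -> vanish_below N g ->
  trunc (M + N) k (cauchy f g) = take_poly k (trunc M k f * trunc N k g).
Proof.
move=> Mf Ng; apply/polyP => j; rewrite coef_poly coef_take_poly.
by case: ifP => // jk; rewrite (coef_trunc_mul Mf Ng jk).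
Qed.

Lemma coefM_take_r (p q : {poly K}) (k j : nat) :
  (j < k)%N -> (p * take_poly k q)`_j = (p * q)`_j.
Proof.
move=> jk; rewrite !coefM; apply: eq_bigr => i _; rewrite coef_take_poly.
by rewrite (leq_ltn_trans (leq_subr _ _) jk).
Qed.

Lemma laurent_mulC : commutative laurent_mul.
Proof.
move=> f g; apply: laurentP => n /=.
have [N Ng] := lcoef_bounded g.
have [M MN Mf] := vanish_below_le f (n - N).
have -> : n = M + N + (absz (n - M - N)%R)%:Z by lia.
rewrite (coef_trunc_mul Mf Ng (ltnSn _)).
by rewrite [M + N]addrC (coef_trunc_mul Ng Mf (ltnSn _)) mulrC.
Qed.

Lemma laurent_mulA : associative laurent_mul.
Proof.
move=> f g h; apply: laurentP => n /=.
have [[N Ng] [P Ph]] := (lcoef_bounded g, lcoef_bounded h).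
have [M MN Mf] := vanish_below_le f (n - N - P).
have E : n = M + (N + P) + (absz (n - M - N - P)%R)%:Z by lia.
set j := absz _ in E; rewrite {}E.
rewrite (coef_trunc_mul Mf (cauchy_vanish Ng Ph) (ltnSn _)).
rewrite addrA (coef_trunc_mul (cauchy_vanish Mf Ng) Ph (ltnSn _)).
rewrite !trunc_mul // [take_poly _ _ * _]mulrC !coefM_take_r //.
by rewrite mulrA [_ * trunc P _ _]mulrC.
Qed.

Lemma laurent_mul1 : left_id laurent1 laurent_mul.
Proof.
move=> f; apply: laurentP => n /=.
have [N Nn Nf] := vanish_below_le f n.
have M1 : vanish_below 0 laurent1 by move=> i /=; case: eqP => // ->.
have -> : n = 0 + N + (absz (n - N)%R)%:Z by lia.
rewrite (coef_trunc_mul M1 Nf (ltnSn _)).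
have -> k : trunc 0 k.+1 laurent1 = 1.
  by apply/polyP => -[|i]; rewrite coef_poly coef1 //=; case: ifP.
by rewrite mul1r coef_poly ltnSn add0r.
Qed.

Lemma laurent_mulDl : left_distributive laurent_mul laurent_add.
Proof.
move=> f g h; apply: laurentP => n /=.
have [[N Ng] [P Ph]] := (lcoef_bounded g, lcoef_bounded h).
have [M] := vanish_below_le f (Num.min N (n - P)).
rewrite le_min => /andP[MN MP] Mf.
have {Ng MN N}Mg := vanish_belowW MN Ng.
have Mfg : vanish_below M (laurent_add f g).
  by move=> i iM /=; rewrite Mf ?Mg ?addr0.
have -> : n = M + P + (absz (n - M - P)%R)%:Z by lia.
rewrite !(coef_trunc_mul _ Ph (ltnSn _)) //.
rewrite -coefD -mulrDl; congr (polyseq (_ * _))`_ _.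
by apply/polyP => i; rewrite coefD !coef_poly; case: ifP; rewrite ?addr0.
Qed.

Lemma laurent_1neq0 : laurent1 != 0.
Proof.
apply/eqP => /(congr1 (fun f : laurent => f 0)) /= /eqP.
by rewrite oner_eq0.
Qed.

HB.instance Definition _ := GRing.Zmodule_isComNzRing.Build laurent
  laurent_mulA laurent_mulC laurent_mul1 laurent_mulDl laurent_1neq0.

(* Coefficients of the inverse of the power series with coefficients [u]. *)
Fixpoint inv_seq (u : nat -> K) (k : nat) : seq K :=
  if k is k'.+1 then
    let s := inv_seq u k' in
    rcons s ((u 0%N)^-1 *
             ((k' == 0)%:R - \sum_(i < k') u (k' - i)%N * s`_i))
  else [::].

Lemma size_inv_seq u k : size (inv_seq u k) = k.
Proof. by elim: k => //= k IHk; rewrite size_rcons IHk. Qed.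

Lemma nth_inv_seq u k j : (j < k)%N -> (inv_seq u k)`_j = (inv_seq u j.+1)`_j.
Proof.
elim: k => // k IHk; rewrite ltnS leq_eqVlt => /predU1P[-> //|jk].
by rewrite -IHk //= nth_rcons size_inv_seq jk.
Qed.

Lemma inv_seqP u j : u 0%N != 0 ->
  \sum_(i < j.+1) u (j - i)%N * (inv_seq u i.+1)`_i = (j == 0)%:R.
Proof.
move=> u0; rewrite big_ord_recr /= subnn nth_rcons size_inv_seq ltnn eqxx.
rewrite mulVKf //.
under eq_bigr => i _ do rewrite -/(inv_seq u i.+1) -(nth_inv_seq u (ltn_ord i)).
by rewrite [LHS]addrC subrK.
Qed.

Lemma laurent_inv_ex (f : laurent) : f != 0 -> exists g, g * f = 1.
Proof.
move=> f0; have [M Mf] := lcoef_bounded f.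
have exf : exists i : nat, f (M + i%:Z) != 0.
  apply: contrapT => nf; case/eqP: f0; apply: laurentP => n /=.
  have [/Mf //|Mn] := ltP n M; apply: contrapT => /eqP fn; case: nf.
  by exists (absz (n - M)%R); have -> : M + (absz (n - M)%R)%:Z = n by lia.
have [v fv vmin] := find_ex_minn exf.
pose V := M + v%:Z.
have Vf : vanish_below V f.
  move=> n nV; have [/Mf //|Mn] := ltP n M; apply: contrapT => /eqP fn.
  suff : (v <= absz (n - M)%R)%N by rewrite /V in nV; lia.
  by apply: vmin; have -> : M + (absz (n - M)%R)%:Z = n by lia.
pose u (i : nat) := f (V + i%:Z).
have u0 : u 0%N != 0 by rewrite /u addr0.
pose w (n : int) := if n < - V then 0
  else (inv_seq u (absz (n + V)%R).+1)`_(absz (n + V)%R).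
have Vw : vanish_below (- V) w by move=> n nV; rewrite /w nV.
have Bw : exists N, vanish_below N w by exists (- V).
exists (Laurent Bw); apply: laurentP => n.
change (cauchy w f n = (n == 0)%:R).
have [n0|n0] := ltP n 0.
  by rewrite (cauchy_vanish Vw Vf) ?addNr // lt_eqF.
have E : n = (absz n)%:Z by lia.
set j := (absz n) in E; rewrite {}E {n0}.
rewrite (cauchyE (k := j.+1) Vw Vf); last by lia.
rewrite eqz_nat -(inv_seqP j u0); apply: eq_bigr => i _.
have ij : (i <= j)%N by rewrite -ltnS.
rewrite mulrC; congr (_ * _); first by congr (f _); lia.
rewrite /w; case: ifPn => [|_]; first by lia.
by have -> : (absz (- V + i%:Z + V)%R) = i by lia.
Qed.

Definition laurent_inv (f : laurent) : laurent :=
  if pselect (exists g, g * f = 1) is left ex then projT1 (cid ex) else 0.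

Lemma laurent_mulVf (f : laurent) : f != 0 -> laurent_inv f * f = 1.
Proof.
move=> /laurent_inv_ex ex; rewrite /laurent_inv; case: pselect => // ex'.
by case: cid.
Qed.

Lemma laurent_inv0 : laurent_inv 0 = 0.
Proof.
rewrite /laurent_inv; case: pselect => // ex; exfalso; case: ex => g.
by rewrite mulr0 => /eqP; rewrite eq_sym oner_eq0.
Qed.

HB.instance Definition _ := GRing.ComNzRing_isField.Build laurent
  laurent_mulVf laurent_inv0.

Lemma laurent_proj_subproof (q j : nat) (f : laurent) :
  exists M, vanish_below M
    (fun n => if (n == j%:Z %[mod q%:Z])%Z then f n else 0).
Proof.
have [M Mf] := lcoef_bounded f; exists M => n nM.
by case: ifP => // _; exact: Mf.
Qed.

(** [p_{q,j}]: keep the terms whose exponent is congruent to [j] modulo [q]. *)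
Definition laurent_proj (q j : nat) (f : laurent) : laurent :=
  Laurent (laurent_proj_subproof q j f).

End LaurentSeries.

(** The formal sum of [x ^ (n ^ 2)] over the integers [n] congruent to [i]
    modulo [l]: its coefficient at [x ^ m] counts, in Z/2, the (finitely many)
    such [n] with [n ^ 2 = m]. *)
Definition theta_coef (l : nat) (i m : int) : 'F_2 :=
  \sum_(n \in [set n : int | (n = i %[mod l%:Z])%Z /\ n ^+ 2 = m]) (1 : 'F_2).

Lemma theta_subproof (l : nat) (i : int) :
  exists M, vanish_below M (theta_coef l i).
Proof.
exists 0 => m m0; rewrite /theta_coef.
suff -> : [set n : int | (n = i %[mod l%:Z])%Z /\ n ^+ 2 = m] = set0.
  by rewrite fsbig_set0.
by apply/seteqP; split => // n [_ nm]; move: m0; rewrite -nm ltNge sqr_ge0.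
Qed.

Definition theta (l : nat) (i : int) : laurent 'F_2 :=
  Laurent (theta_subproof l i).

(* Main.v *)
Require Import Defs.
From mathcomp Require Import all_boot all_order all_algebra.
From mathcomp Require Import zify.
From mathcomp Require Import boolp classical_sets functions cardinality fsbigop.

Import GRing.Theory.
Local Open Scope ring_scope.

(** Write [p_q] for [p_{q,0}]. In characteristic 2, [p_2 (g^2 f) = g^2 p_2 f]
    and [p_{2q} (f^2) = (p_q f)^2]. Two facts on theta series suffice:
    - [p_2 a = b^4]: an even integer congruent to [r] mod 5 is [- 2 k] with [k]
      congruent to [2r];
    - [p_2 (a b) = (a b)^2]: with [(n, m) = (t - s, - s - t)] one has
      [n^2 + m^2 = 2 (s^2 + t^2)], and [(n, m)] is congruent to [(r, 2r)] mod 5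
      if and only if [(s, t)] is.
    Then [p_2 (1/a) = p_2 (a / a^2) = (b^2/a)^2], so [p_2 (b^2/a) = (b^3/a)^2],
    while [p_2 (b^3/a) = p_2 ((b/a)^2 a b) = b^4]. Hence
    [p_8 (1/a) = (p_4 (b^2/a))^2 = (p_2 (b^3/a))^4 = b^16]. *)

Section Laurent.
Variable K : fieldType.
Implicit Types f g : laurent K.

Lemma laurent_mulE f g (n : int) :
  (f * g) n = \sum_(i \in [set: int]) f i * g (n - i).
Proof. by []. Qed.

Lemma laurent_proj0E (q : nat) f (n : int) :
  laurent_proj q 0 f n = if (q%:Z %| n)%Z then f n else 0.
Proof. by rewrite /= mod0z; congr (if _ then _ else _); apply/eqP/dvdz_mod0P. Qed.

Lemma laurent_proj_dvd (d q : nat) f : (d %| q)%N ->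
  laurent_proj q 0 (laurent_proj d 0 f) = laurent_proj q 0 f.
Proof.
move=> dq; apply: laurentP => n; rewrite !laurent_proj0E.
by case: ifP => // qn; rewrite (dvdz_trans _ qn).
Qed.

End Laurent.

Lemma dvdz2_sqr (k : int) : (2%:Z %| k ^+ 2)%Z = (2%:Z %| k)%Z.
Proof. by rewrite !dvdzE abszX Euclid_dvdX ?andbT. Qed.

Lemma F2_sqr (c : 'F_2) : c ^+ 2 = c.
Proof. by case: c => [[|[|c]] ?] //; apply: val_inj. Qed.

(** Squaring is additive in characteristic 2 and fixes the coefficients. *)
Lemma poly_F2_sqr (p : {poly 'F_2}) : p ^+ 2 = p \Po 'X^2.
Proof.
have ch : 2%N \in [pchar {poly 'F_2}] by rewrite pchar_poly pchar_Fp.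
rewrite comp_polyE -[in LHS](coefK p) poly_def -(pFrobenius_autE ch) rmorph_sum.
apply: eq_bigr => i _; rewrite -[LHS]/(_ ^+ 2).
by rewrite exprZn F2_sqr exprAC.
Qed.

(** * Squares of Laurent series over Z/2 and the projections [p_q] *)

Section Frobenius.
Implicit Types f g : laurent 'F_2.

(** A coefficient of a square depends only on a truncation of [f], so the polynomial identity
    carries over; the base point [M] doubles. *)
Lemma laurent_sqr_shift f (M : int) (j : nat) : vanish_below M f ->
  (f ^+ 2) (M + M + j%:Z) = if (2 %| j)%N then f (M + (j %/ 2)%:Z) else 0.
Proof.
move=> Mf; rewrite [LHS](coef_trunc_mul Mf Mf (ltnSn j)) -expr2.
rewrite poly_F2_sqr coef_comp_poly_Xn //; case: ifP => // _.
by rewrite coef_poly ltnS leq_div.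
Qed.

Lemma laurent_sqr_double f (n : int) : (f ^+ 2) (n + n) = f n.
Proof.
have [M Mn Mf] := vanish_below_le f n.
have -> : n + n = M + M + (absz (n - M)%R * 2)%N%:Z by lia.
by rewrite (laurent_sqr_shift _ _ _ Mf) dvdn_mull // mulnK //; congr (f _); lia.
Qed.

Lemma laurent_sqr_odd f (n : int) : ~~ (2%:Z %| n)%Z -> (f ^+ 2) n = 0.
Proof.
move=> n2; have [M Mn Mf] := vanish_below_le f (n %/ 2)%Z.
have -> : n = M + M + (absz (n - M - M)%R)%N%:Z by lia.
by rewrite (laurent_sqr_shift _ _ _ Mf) ifF //; lia.
Qed.

(** As [g ^+ 2] has only even exponents, a nonzero term of the Cauchy product at [n] uses an
    exponent of [f] of the same parity as [n]. *)
Lemma laurent_proj_mul_sqr f g :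
  laurent_proj 2 0 (g ^+ 2 * f) = g ^+ 2 * laurent_proj 2 0 f.
Proof.
apply: laurentP => n; rewrite laurent_proj0E !laurent_mulE.
case: ifPn => n2.
  apply: eq_fsbigr => i _; rewrite laurent_proj0E; case: ifPn => // ni.
  by rewrite (laurent_sqr_odd g i) ?mul0r //; lia.
rewrite fsbig1 // => i _; rewrite laurent_proj0E; case: ifPn => [ni|]; last first.
  by rewrite mulr0.
by rewrite (laurent_sqr_odd g i) ?mul0r //; lia.
Qed.

Lemma laurent_proj_sqr (q : nat) f :
  laurent_proj (2 * q) 0 (f ^+ 2) = laurent_proj q 0 f ^+ 2.
Proof.
apply: laurentP => n; rewrite laurent_proj0E.
have [n2|n2] := boolP (2%:Z %| n)%Z; last first.
  by rewrite !laurent_sqr_odd // if_same.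
have -> : n = (n %/ 2)%Z + (n %/ 2)%Z by lia.
rewrite !laurent_sqr_double laurent_proj0E.
set m := (n %/ 2)%Z; have -> : m + m = 2%:Z * m by lia.
by rewrite PoszM dvdz_mul2l.
Qed.

End Frobenius.

(** * Theta series as finite counts, and the two identities modulo 5 *)

Section Theta.
Local Open Scope classical_set_scope.

Definition int_range (B : nat) : seq int :=
  [seq k%:Z - B%:Z | k <- iota 0 (B + B).+1].

Lemma mem_int_range (B : nat) (n : int) :
  (n \in int_range B) = (- B%:Z <= n <= B%:Z).
Proof.
apply/mapP/idP => [[k]|nB]; first by rewrite mem_iota => kB ->; lia.
by exists (absz (n + B%:Z)%R); [rewrite mem_iota|]; lia.
Qed.

Lemma int_range_uniq (B : nat) : uniq (int_range B).
Proof. by rewrite map_inj_uniq ?iota_uniq // => i j; lia. Qed.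

Lemma theta_coefE (B l : nat) (i m : int) : m <= B%:Z ->
  theta_coef l i m =
  \sum_(n <- int_range B | (n == i %[mod l%:Z])%Z && (n ^+ 2 == m)) 1.
Proof.
move=> mB; rewrite bigfs ?int_range_uniq //=; last first.
  (* The window holds all solutions because [|n| <= n ^+ 2 = m <= B]. *)
  by move=> n /andP[_ /eqP nm]; rewrite mem_int_range; nia.
apply: eq_fsbigl; apply/seteqP; split=> n /=; rewrite unfold_in.
  by case=> -> ->; rewrite !eqxx.
by case/andP=> /eqP ni /eqP.
Qed.

(** Coefficients of a product become counts of pairs, so that an identity between products can be
    proved by a bijection. *)
Lemma theta_mulE (l : nat) (i j N : int) :
  (theta l i * theta l j) N =
  \sum_(p \in [set p : int * int |
    [/\ (p.1 = i %[mod l%:Z])%Z, (p.2 = j %[mod l%:Z])%Z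
      & p.1 ^+ 2 + p.2 ^+ 2 = N]]) (1 : 'F_2).
Proof.
have v0 k : vanish_below 0 (theta l k).
  move=> m m0; rewrite /= (@theta_coefE 0) ?big1 //; last by lia.
  by move=> n /andP[_ /eqP nm]; nia.
rewrite [LHS](cauchyE (k := (absz N).+1) (v0 i) (v0 j)); last by lia.
set B := absz N.
transitivity (\sum_(k < B.+1)
  \sum_(n <- int_range B | (n == i %[mod l%:Z])%Z)
  \sum_(m <- int_range B | (m == j %[mod l%:Z])%Z)
    if (n ^+ 2 == k%:Z) && (m ^+ 2 == N - k%:Z) then 1 else 0 : 'F_2).
  apply: eq_bigr => k _; have kB : (k <= B)%N := ltn_ord k.
  rewrite add0r /= !(@theta_coefE B) //; last by lia.
  rewrite 2!big_mkcondr big_distrlr; apply: eq_bigr => n _; apply: eq_bigr => m _.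
  by case: (n ^+ 2 == _); case: (m ^+ 2 == _); rewrite /= ?mulr0 ?mul0r ?mulr1.
rewrite exchange_big; under eq_bigr do rewrite exchange_big.
transitivity (\sum_(p <- [seq (n, m) | n <- int_range B, m <- int_range B] |
  [&& (p.1 == i %[mod l%:Z])%Z, (p.2 == j %[mod l%:Z])%Z
    & p.1 ^+ 2 + p.2 ^+ 2 == N]) (1 : 'F_2)).
  rewrite [RHS]big_mkcond big_allpairs [LHS]big_mkcond; apply: eq_bigr => n _ /=.
  case: ifP => [ni|]; last by rewrite big1.
  rewrite big_mkcond; apply: eq_bigr => m _ /=; case: ifP => //= mj.
  have [nm|nm] := eqVneq (n ^+ 2 + m ^+ 2) N; last first.
    rewrite big1 // => k _; rewrite ifF //; apply/negP => /andP[/eqP nk /eqP mk].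
    by case/eqP: nm; rewrite nk mk addrC subrK.
  have kN : (absz (n ^+ 2)%R < B.+1)%N by rewrite /B; clear -nm; nia.
  (* For a given pair only the exponent [k = n ^+ 2] contributes. *)
  rewrite (bigD1 (Ordinal kN)) //= big1 ?addr0 ?ifT //.
    have -> : (absz (n ^+ 2)%R)%:Z = n ^+ 2 by clear; lia.
    by rewrite eqxx -nm [_ + m ^+ 2]addrC addrK eqxx.
  move=> k /eqP kn; rewrite ifF //; apply/negbTE/negP => /andP[/eqP nk _].
  by apply: kn; apply: val_inj => /=; rewrite nk.
rewrite bigfs.
- by apply: eq_fsbigl; apply/seteqP; split=> p /=; rewrite unfold_in;
    [case/and3P=> /eqP-> /eqP-> /eqP|case=> -> -> ->]; rewrite ?eqxx.
- by rewrite allpairs_uniq ?int_range_uniq // => -[? ?] [? ?].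
- move=> [n m] /and3P[_ _ /eqP nm] /negP nmB; case: nmB.
  by rewrite /= in nm; rewrite allpairs_f // mem_int_range /B; clear -nm; nia.
Qed.

Lemma theta5_proj (r : int) :
  laurent_proj 2 0 (theta 5 r) = theta 5 (2 * r) ^+ 4.
Proof.
apply: laurentP => n; rewrite laurent_proj0E (exprM _ 2 2).
case: ifPn => n2; last by rewrite laurent_sqr_odd.
have -> : n = (n %/ 2)%Z + (n %/ 2)%Z by lia.
rewrite laurent_sqr_double; set m := (n %/ 2)%Z.
have [m2|m2] := boolP (2%:Z %| m)%Z; last first.
  (* An even square is divisible by 4, so [2 m] is no square for odd [m]. *)
  rewrite laurent_sqr_odd //= /theta_coef fsbig1 // => k [_ km].
  have : (2%:Z %| k)%Z by rewrite -dvdz2_sqr; lia.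
  case/dvdzP => h kh; case/negP: m2; apply/dvdzP; exists (h ^+ 2).
  by move: km; rewrite kh exprMn; lia.
have -> : m = (m %/ 2)%Z + (m %/ 2)%Z by lia.
set h := (m %/ 2)%Z; rewrite laurent_sqr_double /= /theta_coef.
(* If [k] is [2 r] modulo 5, then [- 2 k] is [- 4 r], that is [r]; its square is [4 k ^+ 2]. *)
apply: (reindex_fsbig (fun k : int => - (k + k))).
split.
- by move=> k [kr kh] /=; split; [lia|nia].
- by move=> k k' _ _; lia.
- move=> k [kr kh]; have : (2%:Z %| k)%Z by rewrite -dvdz2_sqr; lia.
  case/dvdzP => c kc; exists (- c) => /=; last by lia.
  by move: kh; rewrite kc exprMn sqrrN; lia.
Qed.

Lemma theta5_proj_mul (r : int) :
  laurent_proj 2 0 (theta 5 r * theta 5 (2 * r)) =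
  (theta 5 r * theta 5 (2 * r)) ^+ 2.
Proof.
apply: laurentP => n; rewrite laurent_proj0E.
case: ifPn => n2; last by rewrite laurent_sqr_odd.
have -> : n = (n %/ 2)%Z + (n %/ 2)%Z by lia.
rewrite laurent_sqr_double !theta_mulE; set m := (n %/ 2)%Z.
(* The inverse of [(s, t) |-> (t - s, - s - t)] halves [x + y], which is even
   exactly when [x ^ 2 + y ^ 2] is. *)
apply: (reindex_fsbig (fun p : int * int => (p.2 - p.1, - p.1 - p.2))).
split.
(* Modulo 5, [2 r - r] is [r] and [- r - 2 r] is [2 r]. *)
- by move=> [s t] [/= sr tr st]; split; [lia|lia|nia].
- by move=> [s t] [s' t'] _ _ [] /= ? ?; congr (_, _); lia.
- move=> [x y] [/= xr yr xy].
  have : (2%:Z %| x + y)%Z by rewrite -dvdz2_sqr sqrrD; lia.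
  (* Modulo 5, [2 c = x + y] is [3 r], so [c] is [- r]; hence [- c] is [r] and [x - c] is [2 r]. *)
  case/dvdzP => c xyc; exists (- c, x - c) => /=; last by congr (_, _); lia.
  by split => /=; [lia|lia|nia].
Qed.

(** The coefficient at [r ^+ 2] is 1: the other root [- r] is not congruent to [r], since 5 does not
    divide [2 r]. *)
Lemma theta5_neq0 (r : int) : ~~ (5%:Z %| r)%Z -> theta 5 r != 0.
Proof.
move=> r5; apply/eqP => /(congr1 (fun f : laurent 'F_2 => f (r ^+ 2))) /=.
rewrite /theta_coef (_ : [set n | _] = [set r]) ?fsbig_set1 //.
apply/seteqP; split=> n /=; last by move=> ->.
case=> nr /eqP; rewrite eqf_sqr => /orP[/eqP//|/eqP n_r].
by case/negP: r5; lia.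
Qed.

End Theta.

Theorem theorem4p1 (r : int) (hr : r = 1 \/ r = 2) :
  let a : laurent 'F_2 := theta 5 r in
  let b : laurent 'F_2 := theta 5 (2 * r) in
  laurent_proj 8 0 (1 / a) = b ^+ 16.
Proof.
move=> a b; have a0 : a != 0 by apply: theta5_neq0; case: hr => ->.
have baab : b / a * (a * b) = b ^+ 2 by rewrite mulrA divfK.
have p2V : laurent_proj 2 0 (1 / a) = (b ^+ 2 / a) ^+ 2.
  have -> : 1 / a = a^-1 ^+ 2 * a by rewrite expr2 -mulrA mulVf // mulr1 div1r.
  by rewrite laurent_proj_mul_sqr theta5_proj -/b exprMn -exprM mulrC.
have p2b2 : laurent_proj 2 0 (b ^+ 2 / a) = (b ^+ 3 / a) ^+ 2.
  by rewrite -[a^-1]div1r laurent_proj_mul_sqr p2V -exprMn mulrA -exprS div1r.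
have p2b3 : laurent_proj 2 0 (b ^+ 3 / a) = b ^+ 4.
  have -> : b ^+ 3 / a = (b / a) ^+ 2 * (a * b).
    by rewrite expr2 -mulrA baab [RHS]mulrAC -exprS.
  by rewrite laurent_proj_mul_sqr theta5_proj_mul -/a -/b -exprMn baab -exprM.
(* Inserting [p_2] under [p_8] exposes a square, and pulling the square out halves the modulus; a
   second round leaves [p_2]. *)
rewrite -(@laurent_proj_dvd _ 2) // p2V (laurent_proj_sqr 4).
rewrite -(@laurent_proj_dvd _ 2) // p2b2 (laurent_proj_sqr 2) p2b3.
by rewrite -!exprM.
Qed.
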